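(* Let $N_2$ be a positive rational number and let $(X_2,Y_2)$ and $(Z_2,W_2)$ be rational points on the curve $C_{N_2}: y^2=x^3-N_2^2x$ with $Y_2\neq 0$, $W_2\neq 0$, $X_2\neq Z_2$, and such that $X_2Z_2$ is the square of a rational number; let $\sqrt{X_2Z_2}$ denote its positive square root. (i) For every positive rational number $a$, the numbers $$b=\Big|\frac{2Y_2W_2}{(X_2-Z_2)(N_2^2-X_2Z_2)}\Big|\,a,\quad c=\frac{2N_2\sqrt{X_2Z_2}}{|N_2^2-X_2Z_2|}\,a,\quad d_{bc}=\frac{2\sqrt{X_2Z_2}}{|X_2-Z_2|}\,a,$$ $$d_{ac}=\frac{N_2^2+X_2Z_2}{|N_2^2-X_2Z_2|}\,a,\quad d_s=\Big|\frac{X_2+Z_2}{X_2-Z_2}\Big|\,a$$ are positive rational numbers and $(a,b,c,d_{bc},d_{ac},d_s)$ is a nearly-perfect cuboid; its face diagonal $d_{ab}=\sqrt{a^2+b^2}$ equals $\sqrt{1+\Big(\frac{2Y_2W_2}{(X_2-Z_2)(N_2^2-X_2Z_2)}\Big)^2}\cdot a$. (ii) Conversely, every nearly-perfect cuboid is obtained in this way for some such $N_2$, $(X_2,Y_2)$, $(Z_2,W_2)$ and $a$. (iii) In particular, a perfect cuboid exists if and only if for some such data the number $\sqrt{1+\Big(\frac{2Y_2W_2}{(X_2-Z_2)(N_2^2-X_2Z_2)}\Big)^2}\cdot a$ is rational.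
   Context: For a nonzero rational $N$, the congruent number curve is $C_N: y^2=x^3-N^2x$; a rational point $(x,y)$ on it is called nontrivial if $y\neq 0$. A nearly-perfect cuboid (NPC) here means a sextuple of positive rational numbers $(a,b,c,d_{bc},d_{ac},d_s)$ with $b^2+c^2=d_{bc}^2$, $a^2+c^2=d_{ac}^2$, $a^2+b^2+c^2=d_s^2$ (the remaining face diagonal $d_{ab}=\sqrt{a^2+b^2}$ may be irrational). A perfect cuboid is a triple of positive rationals $a,b,c$ such that $a^2+b^2$, $b^2+c^2$, $a^2+c^2$ and $a^2+b^2+c^2$ are all squares of rational numbers. *)

(* Defs.v *)
From mathcomp Require Import all_boot all_order all_algebra.
From mathcomp Require Import boolp classical_sets reals.
Set Implicit Arguments.
Unset Strict Implicit.
Unset Printing Implicit Defensive.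
Import Order.TTheory GRing.Theory Num.Theory.
Local Open Scope ring_scope.

Definition on_congruent_curve (N x y : rat) : Prop :=
  y ^+ 2 = x ^+ 3 - N ^+ 2 * x.

Definition rat_square (q : rat) : Prop := exists r : rat, q = r ^+ 2.

(* The nonnegative rational square root of q, with the junk value 0 when q is
   not the square of a rational. *)
Definition rat_sqrt (q : rat) : rat :=
  xget 0 [set s : rat | 0 <= s /\ s ^+ 2 = q]%classic.

Definition nearly_perfect_cuboid (a b c dbc dac ds : rat) : Prop :=
  [/\ 0 < a, 0 < b & 0 < c] /\
  [/\ 0 < dbc, 0 < dac & 0 < ds] /\
  [/\ b ^+ 2 + c ^+ 2 = dbc ^+ 2,
      a ^+ 2 + c ^+ 2 = dac ^+ 2 &
      a ^+ 2 + b ^+ 2 + c ^+ 2 = ds ^+ 2].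

Definition perfect_cuboid (a b c : rat) : Prop :=
  [/\ 0 < a, 0 < b & 0 < c] /\
  [/\ rat_square (a ^+ 2 + b ^+ 2),
      rat_square (b ^+ 2 + c ^+ 2),
      rat_square (a ^+ 2 + c ^+ 2) &
      rat_square (a ^+ 2 + b ^+ 2 + c ^+ 2)].

Definition admissible (N X Y Z W : rat) : Prop :=
  [/\ 0 < N, on_congruent_curve N X Y & on_congruent_curve N Z W] /\
  [/\ Y <> 0, W <> 0, X <> Z & rat_square (X * Z)].

Definition ratio_ba (N X Y Z W : rat) : rat :=
  2 * Y * W / ((X - Z) * (N ^+ 2 - X * Z)).

Definition npc_b (N X Y Z W a : rat) : rat := `|ratio_ba N X Y Z W| * a.

Definition npc_c (N X Z a : rat) : rat :=
  2 * N * rat_sqrt (X * Z) / `|N ^+ 2 - X * Z| * a.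

Definition npc_dbc (X Z a : rat) : rat :=
  2 * rat_sqrt (X * Z) / `|X - Z| * a.

Definition npc_dac (N X Z a : rat) : rat :=
  (N ^+ 2 + X * Z) / `|N ^+ 2 - X * Z| * a.

Definition npc_ds (X Z a : rat) : rat := `|(X + Z) / (X - Z)| * a.

Definition npc_dab (R : realType) (N X Y Z W a : rat) : R :=
  Num.sqrt (1 + ratr (ratio_ba N X Y Z W) ^+ 2) * ratr a.

(* Main.v *)
(** The curve equations give [Y^2 W^2 = X Z (X^2 - N^2) (Z^2 - N^2)], which turns
    the three cuboid relations into polynomial identities; the denominators do
    not vanish because [X Z = N^2] would force [W^2 X^4 = - N^4 Y^2].
    Conversely, the required ratios are [X / Z = (ds + a) / (ds - a)] and
    [N / sqrt (X Z) = (dac + a) / c]; the remaining common scale, and the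
    negative sign of [X] and [Z], are chosen so that both curve equations have
    rational solutions [Y] and [W]. *)

Require Import Defs.
From mathcomp Require Import all_boot all_order all_algebra.
From mathcomp Require Import classical_sets reals.
From mathcomp Require Import ring.
Import Order.TTheory GRing.Theory Num.Theory.
Local Open Scope ring_scope.

Lemma sqr_norm_rat (x : rat) : `|x| ^+ 2 = x ^+ 2.
Proof. by rewrite real_normK ?num_real. Qed.

(** Squaring is injective on nonnegative rationals, so the choice made by [xget] is forced and the
    default 0 is never reached. *)
Lemma rat_sqrt_eq (q s : rat) : 0 <= s -> s ^+ 2 = q -> rat_sqrt q = s.
Proof.
move=> s0 sq; apply: xget_unique => // t [t0 tq].
by apply/eqP; rewrite -(@eqrXn2 _ 2) // tq sq.
Qed.

Lemma rat_square_sqrt (q : rat) :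
  rat_square q -> 0 <= rat_sqrt q /\ rat_sqrt q ^+ 2 = q.
Proof.
by case=> r ->; rewrite (@rat_sqrt_eq _ `|r|) ?normr_ge0 ?sqr_norm_rat.
Qed.

Lemma congruent_curve_neq0 {N X Y : rat} :
  on_congruent_curve N X Y -> Y <> 0 -> X != 0.
Proof.
move=> hY Y0; apply/eqP => X0; apply: Y0; apply/eqP.
by rewrite -sqrf_eq0 hY X0 expr0n /= mulr0 subr0.
Qed.

Lemma curve_product_neq {N X Y Z W : rat} :
  on_congruent_curve N X Y -> on_congruent_curve N Z W ->
  0 < N -> Y <> 0 -> W <> 0 -> N ^+ 2 - X * Z != 0.
Proof.
rewrite /on_congruent_curve => hY hW N0 Y0 W0; apply/eqP => h.
have X0 := congruent_curve_neq0 hY Y0.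
(* Adding the 2-torsion point (0,0) to (X,Y) gives abscissa -N^2/X and an ordinate whose square is
   (N^2 Y/X^2)^2. The cubic is odd, so at Z = N^2/X it takes the opposite value, W^2 = -(N^2
   Y/X^2)^2. *)
have hE : W ^+ 2 * X ^+ 4 + N ^+ 4 * Y ^+ 2 = 0.
  have hN : N ^+ 2 = X * Z by apply/eqP; rewrite -subr_eq0 h.
  have -> : N ^+ 4 = (X * Z) ^+ 2 by rewrite -hN -exprM.
  by rewrite hW hY hN; ring.
have p1 : 0 < W ^+ 2 * X ^+ 4.
  by rewrite mulr_gt0 ?exprn_even_gt0 //; apply/eqP.
have p2 : 0 < N ^+ 4 * Y ^+ 2.
  by rewrite mulr_gt0 ?(exprn_gt0 _ N0) ?exprn_even_gt0 //; apply/eqP.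
by move: (addr_gt0 p1 p2); rewrite hE ltxx.
Qed.

Lemma npc_of_curve_points {N X Y Z W : rat} : admissible N X Y Z W ->
  forall a : rat, 0 < a ->
  nearly_perfect_cuboid a (npc_b N X Y Z W a) (npc_c N X Z a)
    (npc_dbc X Z a) (npc_dac N X Z a) (npc_ds X Z a).
Proof.
move=> [[N0 hY hW] [Y0 W0 XZ sqXZ]] a a0.
have nX := congruent_curve_neq0 hY Y0.
have nZ := congruent_curve_neq0 hW W0.
have nP := curve_product_neq hY hW N0 Y0 W0.
have nD : X - Z != 0 by rewrite subr_eq0; apply/eqP.
have [s0 s2] := rat_square_sqrt _ sqXZ.
rewrite /npc_b /npc_c /npc_dbc /npc_dac /npc_ds /ratio_ba.
move: (rat_sqrt _) s0 s2 => s s0 s2.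
have nXZ : X * Z != 0 by rewrite mulf_neq0.
have sp : 0 < s.
  by rewrite lt_neqAle s0 andbT eq_sym -sqrf_eq0 s2.
have XZp : 0 < X * Z by rewrite -s2 exprn_gt0.
(* Needed for [npc_ds] to be positive: X = -Z would make X Z = -Z^2 nonpositive. *)
have nS : X + Z != 0.
  apply/eqP => /eqP; rewrite addr_eq0 => /eqP hX.
  by move: XZp; rewrite hX mulNr oppr_gt0 ltNge sqr_ge0.
split; [split=> // | split; [split | split]].
- rewrite mulr_gt0 // normr_gt0 mulf_neq0 ?invr_neq0 ?mulf_neq0 //;
  exact/eqP.
- by rewrite mulr_gt0 // divr_gt0 ?normr_gt0 // !mulr_gt0.
- by rewrite mulr_gt0 // divr_gt0 ?normr_gt0 // !mulr_gt0.
- by rewrite mulr_gt0 // divr_gt0 ?normr_gt0 // addr_gt0 // exprn_gt0.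
- by rewrite mulr_gt0 // normr_gt0 mulf_neq0 ?invr_neq0.
- rewrite !exprMn !exprVn !sqr_norm_rat !exprMn !exprVn !exprMn s2 hY hW.
  by field; rewrite nD nP.
(* The triangle on a, c and [dac] is the classical parametrisation (N^2 - s^2)^2 + (2 N s)^2 = (N^2
   + s^2)^2. *)
- rewrite !exprMn !exprVn !sqr_norm_rat s2.
  by field.
- rewrite !exprMn !exprVn !sqr_norm_rat !exprMn !exprVn !exprMn s2 hY hW.
  by field; rewrite nD nP.
Qed.

Lemma npc_dabE (R : realType) (N X Y Z W a : rat) : 0 < a ->
  Num.sqrt (ratr a ^+ 2 + ratr (npc_b N X Y Z W a) ^+ 2) =
  npc_dab R N X Y Z W a.
Proof.
move=> a0; rewrite /npc_dab /npc_b; set q := ratio_ba _ _ _ _ _.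
have -> : ratr a ^+ 2 + ratr (`|q| * a) ^+ 2 =
          (1 + ratr q ^+ 2) * ratr a ^+ 2 :> R.
  rewrite rmorphM /= ratr_norm (exprMn _ `|_|) real_normK ?num_real //.
  by ring.
rewrite sqrtrM ?addr_ge0 ?ler01 ?sqr_ge0 // sqrtr_sqr ger0_norm //.
by rewrite ler0q ltW.
Qed.

Lemma curve_points_of_npc {a b c dbc dac ds : rat} :
  nearly_perfect_cuboid a b c dbc dac ds ->
  exists N X Y Z W : rat, admissible N X Y Z W /\
    [/\ b = npc_b N X Y Z W a, c = npc_c N X Z a, dbc = npc_dbc X Z a,
        dac = npc_dac N X Z a & ds = npc_ds X Z a].
Proof.
move=> [[a0 b0 c0] [[dbc0 dac0 ds0] [hbc hac hs]]].
(* The three right triangles with hypotenuses [ds], [dac] and [ds], each in factored form. *)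
have hdbc : dbc ^+ 2 = (ds - a) * (ds + a) by rewrite -hbc -subr_sqr -hs; ring.
have hc : c ^+ 2 = (dac - a) * (dac + a) by rewrite -subr_sqr -hac; ring.
have hb : b ^+ 2 = (ds - dac) * (ds + dac) by rewrite -subr_sqr -hs -hac; ring.
have Q0 : 0 < dac - a.
  by rewrite -(pmulr_lgt0 _ (addr_gt0 dac0 a0)) -hc exprn_gt0.
have P0 : 0 < ds - a.
  by rewrite -(pmulr_lgt0 _ (addr_gt0 ds0 a0)) -hdbc exprn_gt0.
(* The common scale. With X, Z and N below, Z^3 - N^2 Z = k^3 (2 a (ds + dac)) ((ds - a)(dac -
   a))^2, a square for this k. Likewise X^3 - N^2 X = k^3 (2 a (ds - dac)) ((ds + a)(dac - a))^2
   becomes a square because ds^2 - dac^2 = b^2. Obtaining k from an existential keeps it opaque to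
   [ring] and [field]. *)
have [k kE] : exists k, k = 2 * a * (ds + dac) by eexists.
have k0 : 0 < k by rewrite kE !mulr_gt0 // addr_gt0.
have k20 : 0 < k ^+ 2 by rewrite exprn_gt0.
have PP0 : 0 < ds + a by rewrite addr_gt0.
pose N := k * c * dbc.
pose X := - (k * (ds + a) * (dac - a)).
pose Z := - (k * (ds - a) * (dac - a)).
pose Y := 2 * a * b * k * (ds + a) * (dac - a).
pose W := k ^+ 2 * (ds - a) * (dac - a).
have N0 : 0 < N by rewrite !mulr_gt0.
have Y0 : 0 < Y by rewrite !mulr_gt0.
have W0 : 0 < W by rewrite !mulr_gt0.
have XZE : X * Z = (k * dbc * (dac - a)) ^+ 2.
  by rewrite [RHS]exprMn [(k * _) ^+ 2]exprMn hdbc /X /Z; ring.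
have N2 : N ^+ 2 = k ^+ 2 * ((dac - a) * (dac + a)) * ((ds - a) * (ds + a)).
  by rewrite /N !exprMn hc hdbc.
have DE : X - Z = - (2 * a * k * (dac - a)) by rewrite /X /Z; ring.
have D0 : 0 < 2 * a * k * (dac - a) by rewrite !mulr_gt0.
have PE : N ^+ 2 - X * Z = 2 * a * k ^+ 2 * dbc ^+ 2 * (dac - a).
  by rewrite N2 /X /Z hdbc; ring.
have PE0 : 0 < 2 * a * k ^+ 2 * dbc ^+ 2 * (dac - a).
  by rewrite !mulr_gt0 // exprn_gt0.
have sE : rat_sqrt (X * Z) = k * dbc * (dac - a).
  by apply: rat_sqrt_eq; rewrite // ltW // !mulr_gt0.
exists N, X, Y, Z, W; split.
  split; split=> //.
  - by rewrite /on_congruent_curve N2 /Y !exprMn hb /X kE; ring.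
  - by rewrite /on_congruent_curve N2 /W /Z kE; ring.
  - by move=> h; rewrite h ltxx in Y0.
  - by move=> h; rewrite h ltxx in W0.
  - by move=> h; move: DE D0; rewrite h subrr => /esym/eqP;
       rewrite oppr_eq0 => /eqP ->; rewrite ltxx.
  - by exists (k * dbc * (dac - a)).
have [na nk ndbc] : [/\ a != 0, k != 0 & dbc != 0] by rewrite !gt_eqF.
have [nQ nP nPP] : [/\ dac - a != 0, ds - a != 0 & ds + a != 0].
  by rewrite !gt_eqF.
split.
- rewrite /npc_b /ratio_ba DE PE.
  (* The sign is negative because X < Z; the absolute value in [npc_b] removes it. *)
  have -> : 2 * Y * W / (- (2 * a * k * (dac - a)) *
      (2 * a * k ^+ 2 * dbc ^+ 2 * (dac - a))) = - (b / a).
    rewrite hdbc /Y /W; field.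
    by rewrite na nk nQ nP nPP.
  by rewrite normrN gtr0_norm ?divr_gt0 // divfK.
- by rewrite /npc_c PE sE gtr0_norm // /N; field; rewrite na nk nQ ndbc.
- by rewrite /npc_dbc DE sE normrN gtr0_norm //; field; rewrite na nk nQ.
- rewrite /npc_dac PE gtr0_norm // N2 XZE !exprMn hdbc.
  by field; rewrite na nk nQ nP nPP.
- rewrite /npc_ds DE /X /Z.
  have -> : (- (k * (ds + a) * (dac - a)) - k * (ds - a) * (dac - a)) /
      - (2 * a * k * (dac - a)) = ds / a by field; rewrite na nk nQ.
  by rewrite gtr0_norm ?divr_gt0 // divfK.
Qed.

Lemma rat_square_pos (q : rat) :
  0 < q -> rat_square q -> exists2 r : rat, 0 < r & q = r ^+ 2.
Proof.
move=> q0 [r qr]; exists `|r|; last by rewrite sqr_norm_rat.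
by rewrite normr_gt0; apply: contraTneq q0 => r0; rewrite qr r0 expr0n ltxx.
Qed.

Lemma perfect_cuboid_npc {a b c : rat} : perfect_cuboid a b c ->
  exists dbc dac ds : rat, nearly_perfect_cuboid a b c dbc dac ds.
Proof.
move=> [[a0 b0 c0] [_ hbc hac hs]].
have [a2 b2 c2] : [/\ 0 < a ^+ 2, 0 < b ^+ 2 & 0 < c ^+ 2].
  by rewrite !exprn_gt0.
have [dbc ? ?] := rat_square_pos _ (addr_gt0 b2 c2) hbc.
have [dac ? ?] := rat_square_pos _ (addr_gt0 a2 c2) hac.
have [ds ? ?] := rat_square_pos _ (addr_gt0 (addr_gt0 a2 b2) c2) hs.
by exists dbc, dac, ds.
Qed.

Lemma perfect_cuboid_of_npc (a b c dbc dac ds : rat) :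
  nearly_perfect_cuboid a b c dbc dac ds -> rat_square (a ^+ 2 + b ^+ 2) ->
  perfect_cuboid a b c.
Proof.
move=> [pos [_ [hbc hac hs]]] hab; split=> //; split=> //.
- by exists dbc.
- by exists dac.
- by exists ds.
Qed.

(** The embedding of the rationals in [R] is injective, so an equation q^2 = a^2 + b^2 that holds in
    [R] descends to the rationals. *)
Lemma sqrt_ratr_rational (R : realType) (a b : rat) :
  (exists q : rat, Num.sqrt (ratr a ^+ 2 + ratr b ^+ 2) = ratr q :> R) <->
  rat_square (a ^+ 2 + b ^+ 2).
Proof.
split=> [[q hq]|[r hr]].
  exists q; apply: (fmorph_inj (@ratr R)).
  rewrite rmorphXn /= -hq sqr_sqrtr ?addr_ge0 ?sqr_ge0 //.
  by rewrite rmorphD !rmorphXn.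
exists `|r|; rewrite -!rmorphXn -rmorphD /= hr rmorphXn /= sqrtr_sqr.
by rewrite ratr_norm.
Qed.

Theorem theorem5 (R : realType) :
  (forall N X Y Z W : rat, admissible N X Y Z W ->
     forall a : rat, 0 < a ->
       nearly_perfect_cuboid a (npc_b N X Y Z W a) (npc_c N X Z a)
         (npc_dbc X Z a) (npc_dac N X Z a) (npc_ds X Z a) /\
       Num.sqrt (ratr a ^+ 2 + ratr (npc_b N X Y Z W a) ^+ 2) =
         npc_dab R N X Y Z W a)
  /\
  (forall a b c dbc dac ds : rat, nearly_perfect_cuboid a b c dbc dac ds ->
     exists N X Y Z W : rat, admissible N X Y Z W /\
       [/\ b = npc_b N X Y Z W a, c = npc_c N X Z a, dbc = npc_dbc X Z a,
           dac = npc_dac N X Z a & ds = npc_ds X Z a])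
  /\
  ((exists a b c : rat, perfect_cuboid a b c) <->
   (exists N X Y Z W a : rat,
      [/\ admissible N X Y Z W, 0 < a &
          exists q : rat, npc_dab R N X Y Z W a = ratr q])).
Proof.
split; [|split; [|split]].
- move=> N X Y Z W adm a a0; split; first exact: npc_of_curve_points.
  exact: npc_dabE.
- by move=> a b c dbc dac ds; apply: curve_points_of_npc.
- move=> [a [b [c pc]]].
  have [[a0 _ _] [hab _ _ _]] := pc.
  have [dbc [dac [ds npc]]] := perfect_cuboid_npc pc.
  have [N [X [Y [Z [W [adm [hb _ _ _ _]]]]]]] := curve_points_of_npc npc.
  exists N, X, Y, Z, W, a; split=> //.
  (* The recovered data reproduce the original b with the same a, so the real number in question is
     the face diagonal of the given perfect cuboid. *)
  by rewrite -npc_dabE // -hb; apply/sqrt_ratr_rational.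
- move=> [N [X [Y [Z [W [a [adm a0]]]]]]]; rewrite -npc_dabE //.
  move=> /sqrt_ratr_rational hab.
  exists a, (npc_b N X Y Z W a), (npc_c N X Z a).
  exact: perfect_cuboid_of_npc (npc_of_curve_points adm a a0) hab.
Qed.
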